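(* Let $n\ge 1$ be an integer, let $x_i, a_i$ ($i=1,\dots,n$) be complex numbers, let $p>1$ and let $q$ be defined by $\frac1p+\frac1q=1$. Let $\mu_1,\dots,\mu_n,\lambda$ be nonzero real numbers. Case (i): If $\mu_i>0$ for $i=1,\dots,n$, $\lambda>0$, and $$|\lambda|^{\frac1{p-1}}\ \ge\ \sum_{i=1}^n |\mu_i|^{\frac1{p-1}}|a_i|^q,$$ then $$\sum_{i=1}^n \frac{|x_i|^p}{\mu_i}\ \ge\ \frac{\left|\sum_{i=1}^n a_ix_i\right|^p}{\lambda}.$$ Case (ii): If $\mu_1>0$, $\mu_i<0$ for $i=2,\dots,n$, $\lambda>0$, and $$|\lambda|^{\frac1{p-1}}\ \le\ |\mu_1|^{\frac1{p-1}}|a_1|^q-\sum_{i=2}^n |\mu_i|^{\frac1{p-1}}|a_i|^q,$$ then $$\sum_{i=1}^n \frac{|x_i|^p}{\mu_i}\ \le\ \frac{\left|\sum_{i=1}^n a_ix_i\right|^p}{\lambda}.$$ Case (iii): If $\mu_1<0$, $\mu_i>0$ for $i=2,\dots,n$, $\lambda<0$, and $$|\lambda|^{\frac1{p-1}}\ \le\ |\mu_1|^{\frac1{p-1}}|a_1|^q-\sum_{i=2}^n |\mu_i|^{\frac1{p-1}}|a_i|^q,$$ then $$\sum_{i=1}^n \frac{|x_i|^p}{\mu_i}\ \ge\ \frac{\left|\sum_{i=1}^n a_ix_i\right|^p}{\lambda}.$$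
   Context: All powers are real powers of nonnegative real numbers. *)

(* Defs.v *)
From mathcomp Require Export all_boot all_order all_algebra.
From mathcomp Require Export complex.
From mathcomp Require Export reals exp.

(* Every base of a power [_ `^ _] here is a nonnegative real, where [powR] is
   the usual real power ([0 `^ s = 0] for [s != 0]).  [normc z : R] is the
   modulus of [z : R[i]] as an element of [R]; the generic norm [`|z|] would
   live in [R[i]]. *)

(* Main.v *)
Require Import Defs.
From mathcomp Require Import hoelder.
Import Order.TTheory GRing.Theory Num.Theory Normc.
Local Open Scope ring_scope.
Local Open Scope complex_scope.

(** Everything rests on one inequality, the weighted form of Hoelder's inequality
    [powR_sum_le]: for weights [m i > 0] and nonnegative [b i], [y i],
    (sum b y)^p <= (sum m^(1/(p-1)) b^q)^(p-1) * (sum y^p / m).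
    It is Hoelder's inequality for the products of m^(1/p) b and y / m^(1/p),
    raised to the power p, because q / p = 1 / (p - 1) and p / q = p - 1.

    When all weights are positive ([normc_sum_powR_le]), the triangle inequality
    gives |sum a x| <= sum |a| |x|, and the hypothesis says that the first factor
    is at most lambda.

    When exactly one weight, say mu_1, has the sign of lambda, put S = sum a x;
    then a_1 x_1 is S minus the other a_i x_i.  So |a_1 x_1| is bounded by a sum
    of the same shape, in which the term 1 * |S| with weight |lambda| takes the
    place of the first one.  By the hypothesis the first factor is now at most
    |mu_1| |a_1|^p, so that the weighted inequality reads
    |a_1|^p |x_1|^p <= |mu_1| |a_1|^p (|S|^p / |lambda| + sum |x_i|^p / |mu_i|)
    with i ranging over the other indices.  The hypothesis also forces a_1 to be
    nonzero, since lambda is, and |a_1|^p cancels ([normc_term_powR_le]).  The two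
    mixed sign patterns are this inequality with its terms moved across. *)

(** * Weighted Hoelder inequality for finite sums *)

Section WeightedHoelder.
Context {R : realType}.
Implicit Types p q : R.

(** The two-term inequality says that triples [(s, u, v)] with
    [s <= u^(1/p) v^(1/q)] can be added up, whence the case of any finite sum. *)
Lemma hoelder_sum {I : Type} (r : seq I) (P : pred I) {f g : I -> R} {p q} :
    0 < p -> 0 < q -> p^-1 + q^-1 = 1 ->
    (forall i, 0 <= f i) -> (forall i, 0 <= g i) ->
  \sum_(i <- r | P i) f i * g i <=
    (\sum_(i <- r | P i) f i `^ p) `^ p^-1 *
    (\sum_(i <- r | P i) g i `^ q) `^ q^-1.
Proof.
move=> p0 q0 pq f0 g0.
pose K (s u v : R) := [/\ 0 <= u, 0 <= v & s <= u `^ p^-1 * v `^ q^-1].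
have powRVK (u t : R) : 0 < t -> 0 <= u -> (u `^ t^-1) `^ t = u.
  by move=> t0 u0; rewrite -powRrM mulVf ?gt_eqF// powRr1.
suff [] : K (\sum_(i <- r | P i) f i * g i) (\sum_(i <- r | P i) f i `^ p)
            (\sum_(i <- r | P i) g i `^ q) by [].
apply: (big_rec3 K) => [|i s u v _ [u0 v0 suv]].
  by split=> //; rewrite mulr_ge0 ?powR_ge0.
split; rewrite ?addr_ge0 ?powR_ge0//.
apply: le_trans (lerD (lexx _) suv) _.
have := hoelder2 (f0 i) (powR_ge0 u p^-1) (g0 i) (powR_ge0 v q^-1) p0 q0 pq.
by rewrite !powRVK.
Qed.

Section ConjugateExponents.
Context {p q : R}.
Hypotheses (p_gt1 : 1 < p) (pq : 1 / p + 1 / q = 1).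

Let p_gt0 : 0 < p := lt_trans ltr01 p_gt1.
Let p_neq0 : p != 0 := lt0r_neq0 p_gt0.
Let pB1_gt0 : 0 < p - 1. Proof. by rewrite subr_gt0. Qed.
Let pB1_neq0 : p - 1 != 0 := lt0r_neq0 pB1_gt0.

Lemma conjugate_exponentE : q = p / (p - 1).
Proof.
have qE : q^-1 = (p - 1) / p.
  by rewrite mulrBl divff// -{1}pq !div1r addrC addKr.
by rewrite -[q]invrK qE invf_div.
Qed.

(** The unweighted inequality is applied to m^(1/p) b and y / m^(1/p): the
    weights cancel in the products, and the exponents [q] and [p] turn them into
    m^(1/(p-1)) and 1/m.  Nothing is divided by [b], which may vanish. *)
Lemma powR_sum_le {I : finType} {m b y : I -> R} :
    (forall i, 0 < m i) -> (forall i, 0 <= b i) -> (forall i, 0 <= y i) ->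
  (\sum_i b i * y i) `^ p <=
    (\sum_i m i `^ (1 / (p - 1)) * b i `^ q) `^ (p - 1) *
    \sum_i y i `^ p / m i.
Proof.
move=> m0 b0 y0.
have q0 : 0 < q by rewrite conjugate_exponentE divr_gt0.
have qp : q^-1 + p^-1 = 1 by move: pq; rewrite !div1r addrC.
have w0 i : 0 < m i `^ p^-1 by rewrite powR_gt0.
have w_neq0 i : m i `^ p^-1 != 0 := lt0r_neq0 (w0 i).
have wq i : (m i `^ p^-1 * b i) `^ q = m i `^ (1 / (p - 1)) * b i `^ q.
  by rewrite powRM ?powR_ge0// -powRrM conjugate_exponentE mulKf// div1r.
have wp i : (y i / m i `^ p^-1) `^ p = y i `^ p / m i.
  rewrite powRM ?invr_ge0 ?powR_ge0// -powRN -powRrM mulNr mulVf//.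
  by rewrite powR_inv1 ?ltW.
have hoelder : \sum_i b i * y i <=
    (\sum_i m i `^ (1 / (p - 1)) * b i `^ q) `^ q^-1 *
    (\sum_i y i `^ p / m i) `^ p^-1.
  have f0 i : 0 <= m i `^ p^-1 * b i by rewrite mulr_ge0 ?powR_ge0.
  have g0 i : 0 <= y i / m i `^ p^-1 by rewrite divr_ge0 ?powR_ge0.
  rewrite -(eq_bigr _ (fun i _ => wq i)) -(eq_bigr _ (fun i _ => wp i)).
  apply: le_trans (hoelder_sum (index_enum I) xpredT q0 p_gt0 qp f0 g0).
  by apply: ler_sum => i _; rewrite [m i `^ _ * _]mulrC mulrACA divff// mulr1.
apply: le_trans (ge0_ler_powR (ltW p_gt0) _ _ hoelder) _.
- by rewrite nnegrE sumr_ge0// => i _; rewrite mulr_ge0 ?powR_ge0.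
- by rewrite nnegrE mulr_ge0 ?powR_ge0.
have X0 : 0 <= \sum_i y i `^ p / m i.
  by apply: sumr_ge0 => i _; rewrite divr_ge0 ?powR_ge0 ?ltW.
rewrite powRM ?powR_ge0// -!powRrM mulVf// powRr1//.
by rewrite conjugate_exponentE invf_div divfK.
Qed.

End ConjugateExponents.
End WeightedHoelder.

(** * Moduli of linear combinations of complex numbers *)

Section Moduli.
Context {R : realType} {n : nat} {p q : R}.
Hypotheses (p_gt1 : 1 < p) (pq : 1 / p + 1 / q = 1).
Variables (x a : 'I_n -> R[i]).

Let p_gt0 : 0 < p := lt_trans ltr01 p_gt1.
Let pB1_gt0 : 0 < p - 1. Proof. by rewrite subr_gt0. Qed.

Lemma normc_ge0 (z : R[i]) : 0 <= normc z.
Proof. by case: z => u v; rewrite sqrtr_ge0. Qed.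

Lemma le_normc_sum (P : pred 'I_n) (z : 'I_n -> R[i]) :
  normc (\sum_(i | P i) z i) <= \sum_(i | P i) normc (z i).
Proof.
apply: (big_rec2 (fun u v => normc u <= v)) => [|i u v _ uv].
  by rewrite normc0.
by apply: le_trans (le_normcD _ _) _; rewrite lerD2l.
Qed.

Lemma normc_sum_powR_le {m : 'I_n -> R} {l : R} :
    (forall i, 0 < m i) -> 0 < l ->
    \sum_i m i `^ (1 / (p - 1)) * normc (a i) `^ q <= l `^ (1 / (p - 1)) ->
  normc (\sum_i a i * x i) `^ p / l <= \sum_i normc (x i) `^ p / m i.
Proof.
move=> m0 l0 hl; rewrite ler_pdivrMr// mulrC.
apply: le_trans (_ : (\sum_i normc (a i) * normc (x i)) `^ p <= _).
  have le_S : normc (\sum_i a i * x i) <= \sum_i normc (a i) * normc (x i).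
    by apply: le_trans (le_normc_sum _ _) _; under eq_bigr do rewrite normcM.
  apply: (ge0_ler_powR (ltW p_gt0)) => //; rewrite nnegrE.
    exact: normc_ge0.
  exact: le_trans (normc_ge0 _) le_S.
apply: le_trans (powR_sum_le p_gt1 pq m0 _ _) _;
  do ?[by move=> i; exact: normc_ge0].
apply: ler_wpM2r.
  by apply: sumr_ge0 => i _; rewrite divr_ge0 ?powR_ge0 ?ltW.
apply: le_trans (ge0_ler_powR (ltW pB1_gt0) _ _ hl) _.
- by rewrite nnegrE sumr_ge0// => i _; rewrite mulr_ge0 ?powR_ge0.
- by rewrite nnegrE powR_ge0.
by rewrite -powRrM div1r mulVf ?gt_eqF// powRr1// ltW.
Qed.

(** Solving S = sum a x for its term of index [i1] exchanges the roles of that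
    term and of S, and turns the lower bound for the term of [i1] into the upper
    bound that is fed to [powR_sum_le].  Here [m] and [l] stand for the absolute
    values of weights of mixed signs. *)
Lemma normc_term_powR_le {i1 : 'I_n} {m : 'I_n -> R} {l : R} :
    (forall i, 0 < m i) -> 0 < l ->
    l `^ (1 / (p - 1)) <= m i1 `^ (1 / (p - 1)) * normc (a i1) `^ q -
      \sum_(i | i != i1) m i `^ (1 / (p - 1)) * normc (a i) `^ q ->
  normc (x i1) `^ p / m i1 <=
    normc (\sum_i a i * x i) `^ p / l + \sum_(i | i != i1) normc (x i) `^ p / m i.
Proof.
move=> m0 l0; rewrite lerBrDr; set S := \sum_i _ => hl.
have q_neq0 : q != 0.
  by rewrite (conjugate_exponentE p_gt1 pq) mulf_neq0 ?invr_eq0 ?gt_eqF.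
have a1_gt0 : 0 < normc (a i1).
  rewrite lt_neqAle normc_ge0 andbT; apply/eqP => a10.
  move: hl; rewrite -a10 powR0// mulr0 leNgt ltr_wpDr ?powR_gt0//.
  by apply: sumr_ge0 => i _; rewrite mulr_ge0 ?powR_ge0.
(* Up to signs, a i1 * x i1 is the combination sum c z: index i1 now carries
   the term 1 * S with weight l. *)
pose c := [eta a with i1 |-> 1]; pose z := [eta x with i1 |-> S].
pose w := [eta m with i1 |-> l].
have w_gt0 i : 0 < w i by rewrite /w /=; case: eqP.
have sumE (T : zmodType) (f : 'I_n -> T) :
    \sum_i f i = f i1 + \sum_(i | i != i1) f i by rewrite (bigD1 i1).
have le_a1x1 : normc (a i1) * normc (x i1) <= \sum_i normc (c i) * normc (z i).
  rewrite sumE /c /z /= eqxx normc1 mul1r.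
  under [X in _ + X]eq_bigr => i ii1 do rewrite (negPf ii1) -normcM.
  have -> : normc (a i1) * normc (x i1) =
            normc (S - \sum_(i | i != i1) a i * x i).
    by rewrite /S sumE addrK normcM.
  by apply: le_trans (le_normcD _ _) _; rewrite normcN lerD2l le_normc_sum.
have le_weights : \sum_i w i `^ (1 / (p - 1)) * normc (c i) `^ q <=
                  m i1 `^ (1 / (p - 1)) * normc (a i1) `^ q.
  rewrite sumE /c /w /= eqxx normc1 powR1 mulr1.
  by under [X in _ + X]eq_bigr => i ii1 do rewrite (negPf ii1).
have -> : normc S `^ p / l + \sum_(i | i != i1) normc (x i) `^ p / m i =
          \sum_i normc (z i) `^ p / w i.
  rewrite sumE /z /w /= eqxx; congr (_ + _).
  by apply: eq_bigr => i /negPf ->.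
set X := \sum_i _ / _.
have X_ge0 : 0 <= X.
  by apply: sumr_ge0 => i _; rewrite divr_ge0 ?powR_ge0 ?ltW.
suff : (normc (a i1) * normc (x i1)) `^ p <= m i1 * normc (a i1) `^ p * X.
  rewrite powRM ?normc_ge0// [m i1 * _]mulrC -mulrA ler_pM2l ?powR_gt0//.
  by rewrite ler_pdivrMr// mulrC.
apply: le_trans (ge0_ler_powR (ltW p_gt0) _ _ le_a1x1) _.
- by rewrite nnegrE mulr_ge0 ?normc_ge0.
- by rewrite nnegrE sumr_ge0// => i _; rewrite mulr_ge0 ?normc_ge0.
apply: le_trans (powR_sum_le p_gt1 pq w_gt0 _ _) _;
  do ?[by move=> i; exact: normc_ge0].
apply: ler_wpM2r => //.
apply: le_trans (ge0_ler_powR (ltW pB1_gt0) _ _ le_weights) _.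
- by rewrite nnegrE sumr_ge0// => i _; rewrite mulr_ge0 ?powR_ge0.
- by rewrite nnegrE mulr_ge0 ?powR_ge0.
rewrite powRM ?powR_ge0// -!powRrM div1r mulVf ?gt_eqF// powRr1 ?(ltW (m0 i1))//.
by rewrite (conjugate_exponentE p_gt1 pq) divfK ?gt_eqF.
Qed.

End Moduli.

Theorem theorem2 (R : realType) (n : nat) (n_ge1 : (1 <= n)%N)
    (x a : 'I_n -> R[i]) (p q : R) (p_gt1 : 1 < p) (pq : 1 / p + 1 / q = 1)
    (mu : 'I_n -> R) (lambda : R)
    (mu_neq0 : forall i, mu i != 0) (lambda_neq0 : lambda != 0) :
  let i1 : 'I_n := Ordinal n_ge1 in
  [/\ (* case (i) *)
      (forall i, 0 < mu i) -> 0 < lambda ->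
      `|lambda| `^ (1 / (p - 1)) >=
        \sum_(i < n) `|mu i| `^ (1 / (p - 1)) * normc (a i) `^ q ->
      \sum_(i < n) normc (x i) `^ p / mu i >=
        normc (\sum_(i < n) a i * x i) `^ p / lambda,
      (* case (ii) *)
      0 < mu i1 -> (forall i, i != i1 -> mu i < 0) -> 0 < lambda ->
      `|lambda| `^ (1 / (p - 1)) <=
        `|mu i1| `^ (1 / (p - 1)) * normc (a i1) `^ q -
        \sum_(i < n | i != i1) `|mu i| `^ (1 / (p - 1)) * normc (a i) `^ q ->
      \sum_(i < n) normc (x i) `^ p / mu i <=
        normc (\sum_(i < n) a i * x i) `^ p / lambda
    & (* case (iii) *)
      mu i1 < 0 -> (forall i, i != i1 -> 0 < mu i) -> lambda < 0 ->
      `|lambda| `^ (1 / (p - 1)) <=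
        `|mu i1| `^ (1 / (p - 1)) * normc (a i1) `^ q -
        \sum_(i < n | i != i1) `|mu i| `^ (1 / (p - 1)) * normc (a i) `^ q ->
      \sum_(i < n) normc (x i) `^ p / mu i >=
        normc (\sum_(i < n) a i * x i) `^ p / lambda].
Proof.
move=> i1.
have abs_gt0 i : 0 < `|mu i| by rewrite normr_gt0.
have lambda_gt0 : 0 < `|lambda| by rewrite normr_gt0.
have term_le := normc_term_powR_le p_gt1 pq x a abs_gt0 lambda_gt0.
split.
- move=> mu0 l0; rewrite (gtr0_norm l0).
  under eq_bigr => i do rewrite (gtr0_norm (mu0 i)).
  exact: normc_sum_powR_le.
- move=> mu1 muN l0 /term_le.
  rewrite (gtr0_norm l0) (gtr0_norm mu1).
  under [X in _ + X]eq_bigr => i ii1 do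
    rewrite (ltr0_norm (muN i ii1)) invrN mulrN.
  by rewrite sumrN lerBrDr => ?; rewrite (bigD1 i1).
- move=> mu1 muP l0 /term_le.
  rewrite (ltr0_norm l0) (ltr0_norm mu1) !invrN !mulrN.
  under [X in _ + X]eq_bigr => i ii1 do rewrite (gtr0_norm (muP i ii1)).
  by rewrite lerNl opprD opprK lerBlDr => ?; rewrite [leRHS](bigD1 i1).
Qed.
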